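(* Let $n\geqslant1$, $m\in\mathbb Z^n_\geqslant$, $\ell\in\mathbb Z^n_\geqslant$, and let $c_\alpha\in\mathbb C$ for $\alpha\in\mathbb Z^n_\geqslant$ with $0\leqslant\alpha\leqslant m$. Let $X_m=\{x\in\mathbb Z^n_\geqslant: x\not\geqslant m\}$ and $\varphi\colon X_m\to\mathbb C$. Let $f\colon\mathbb Z^n_\geqslant\to\mathbb C$ be a solution of the Cauchy problem $$P(\delta^{-1})f(x)=\sum_{0\leqslant\alpha\leqslant m}c_\alpha f(x-\alpha)=0\quad (x\geqslant m),\qquad f(x)=\varphi(x)\quad(x\in X_m).$$ Then the discrete generating series $F(\xi;\ell;z)=\sum_{x\in\mathbb Z^n_\geqslant}f(x)\xi^xz^{\underline{\ell x}}$ satisfies $$\mathcal P(\xi,\ell;z)F(\xi;\ell;z)=\sum_{0\leqslant\alpha\leqslant m}c_\alpha\xi^\alpha z^{\underline{\ell\alpha}}\rho^{\ell\alpha}\Phi_{m-\alpha}(\xi,\ell;z)$$ $$=\sum_{x\in X_m}\big(P(\delta^{-1})\varphi(x)\big)\,\xi^xz^{\underline{\ell x}}$$ $$=\sum_{x\in X_m}\mathcal P_{m-x}(\xi,\ell;z)\big[\varphi(x)\,\xi^xz^{\underline{\ell x}}\big].$$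
   Context: $\mathbb Z_\geqslant$ denotes the non-negative integers. For $x,y\in\mathbb Z^n$, $x\leqslant y$ means $x_i\leqslant y_i$ for all $i$, and $x\not\geqslant y$ is the negation of $x\geqslant y$. Multi-index notation: $\xi^x=\xi_1^{x_1}\cdots\xi_n^{x_n}$, $\ell x=(\ell_1x_1,\dots,\ell_nx_n)$, $z^{\underline x}=z_1^{\underline{x_1}}\cdots z_n^{\underline{x_n}}$, where $t^{\underline k}=t(t-1)\cdots(t-k+1)$ is the falling factorial ($t^{\underline0}=1$). Discrete generating series are formal: power series in $\xi_1,\dots,\xi_n$ whose coefficients are polynomials in $z_1,\dots,z_n$; operators in $z$ act coefficientwise. $\rho_j$ is the backward shift in $z_j$ ($\rho_jg(z)=g(z-e_j)$, with $e_j$ the $j$-th unit vector) and $\rho^{\beta}=\rho_1^{\beta_1}\cdots\rho_n^{\beta_n}$; in $z^{\underline{\ell\alpha}}\rho^{\ell\alpha}$ the shift is applied first, then the multiplication. $\delta_j$ is the forward shift $x\mapsto x+e_j$, $\delta^\alpha=\delta_1^{\alpha_1}\cdots\delta_n^{\alpha_n}$, $P(\delta)=\sum_{0\leqslant\alpha\leqslant m}c_\alpha\delta^\alpha$, so $P(\delta^{-1})f(x)=\sum_{0\leqslant\alpha\leqslant m}c_\alpha f(x-\alpha)$. In $P(\delta^{-1})\varphi(x)$ the convention is $\varphi(y)=0$ for $y\notin\mathbb Z^n_\geqslant$. Shift operator and its truncation for $\tau\in\mathbb Z^n$: $$\mathcal P(\xi,\ell;z)=\sum_{0\leqslant\alpha\leqslant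 m}c_\alpha\xi^\alpha z^{\underline{\ell\alpha}}\rho^{\ell\alpha},\qquad \mathcal P_\tau(\xi,\ell;z)=\sum_{0\leqslant\alpha\leqslant m,\ \alpha\not\geqslant\tau}c_\alpha\xi^\alpha z^{\underline{\ell\alpha}}\rho^{\ell\alpha}.$$ Discrete generating series of the initial data, for $\tau\in\mathbb Z^n_\geqslant$ with $\tau\leqslant m$: $\Phi_\tau(\xi,\ell;z)=\sum_{x\in\mathbb Z^n_\geqslant,\ x\not\geqslant\tau}\varphi(x)\xi^xz^{\underline{\ell x}}$. *)

(* Defs.v *)
From HB Require Import structures.
From mathcomp Require Export all_boot all_order all_algebra.
From mathcomp Require Export boolp classical_sets functions cardinality fsbigop.
From mathcomp Require Export reals complex mpoly.

Set Implicit Arguments.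
Unset Strict Implicit.
Unset Printing Implicit Defensive.

Import Order.TTheory GRing.Theory Num.Theory.
Local Open Scope ring_scope.

(* ['X_{1..n}] is Z_{>=0}^n and [Zn n] is Z^n. *)
Definition Zn (n : nat) := {ffun 'I_n -> int}.

Definition zvec n (x : 'X_{1..n}) : Zn n := [ffun i => (x i)%:Z].

Definition leZn n (x y : Zn n) : bool := [forall i, x i <= y i].

(* { x in Z_{>=0}^n : x is not >= t }; the set X_m is [nge (zvec m)]. *)
Definition nge n (t : Zn n) : set 'X_{1..n} :=
  [set x : 'X_{1..n} | ~~ leZn t (zvec x)]%classic.

Section Series.
Variables (K : comNzRingType) (n : nat).

Definition ext0 (g : 'X_{1..n} -> K) (y : Zn n) : K :=
  if [forall i, 0 <= y i] then g [multinom `|y i|%N | i < n] else 0.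

(* P(delta^{-1}) g(x).  The index type 'X_{1..n < (mdeg m).+1} is the finite
   type of multi-indices of total degree <= |m|; it contains every a <= m. *)
Definition Pdelta_inv (m : 'X_{1..n}) (c : 'X_{1..n} -> K)
    (g : Zn n -> K) (x : Zn n) : K :=
  \sum_(a : 'X_{1..n < (mdeg m).+1} | (a <= m)%MM) c a * g (x - zvec a).

Definition ffall (A : comNzRingType) (t : A) (k : nat) : A :=
  \prod_(i < k) (t - i%:R).

Definition zfall (x : 'X_{1..n}) : {mpoly K[n]} :=
  \prod_(i < n) ffall 'X_i (x i).

Definition mscale (l x : 'X_{1..n}) : 'X_{1..n} :=
  [multinom (l i * x i)%N | i < n].

Definition rho (j : 'I_n) (p : {mpoly K[n]}) : {mpoly K[n]} :=
  p \mPo [tuple 'X_i - (i == j)%:R | i < n].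

Definition rho_pow (b : 'X_{1..n}) (p : {mpoly K[n]}) : {mpoly K[n]} :=
  foldr (fun j q => iter (b j) (rho j) q) p (enum 'I_n).

(* Formal power series in xi_1, ..., xi_n with coefficients in K[z_1, ..., z_n]:
   [G y] is the coefficient of xi^y.  Addition and scaling are the pointwise
   ones of a function space. *)
Definition fps := 'X_{1..n} -> {mpoly K[n]}.

(* The single-term series p xi^x. *)
Definition xi_term (x : 'X_{1..n}) (p : {mpoly K[n]}) : fps :=
  fun y => if y == x then p else 0.

(* Multiplication by xi^a. *)
Definition mul_xi (a : 'X_{1..n}) (G : fps) : fps :=
  fun y => if (a <= y)%MM then G (y - a)%MM else 0.

(* The formal sum over x in A of the series G x, taken coefficientwise.
   [\sum_(x \in A)] is 0 when infinitely many terms are nonzero, so [fsum] is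
   meaningful only for [fsummable] families. *)
Definition fsummable (A : set 'X_{1..n}) (G : 'X_{1..n} -> fps) : Prop :=
  forall y : 'X_{1..n},
    finite_set [set x : 'X_{1..n} | A x /\ G x y <> 0]%classic.

Definition fsum (A : set 'X_{1..n}) (G : 'X_{1..n} -> fps) : fps :=
  fun y => \sum_(x \in A) G x y.

(* xi^a z^{\underline{l a}} rho^{l a}, acting on coefficients in z. *)
Definition shift_term (l a : 'X_{1..n}) (G : fps) : fps :=
  mul_xi a (fun y => zfall (mscale l a) * rho_pow (mscale l a) (G y)).

Definition shift_op (m l : 'X_{1..n}) (c : 'X_{1..n} -> K) (G : fps) : fps :=
  \sum_(a : 'X_{1..n < (mdeg m).+1} | (a <= m)%MM) c a *: shift_term l a G.

Definition shift_op_trunc (m l : 'X_{1..n}) (c : 'X_{1..n} -> K) (t : Zn n)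
    (G : fps) : fps :=
  \sum_(a : 'X_{1..n < (mdeg m).+1} | (a <= m)%MM && ~~ leZn t (zvec a))
    c a *: shift_term l a G.

(* a xi^x z^{\underline{l x}} *)
Definition gen_term (l x : 'X_{1..n}) (a : K) : fps :=
  xi_term x (a *: zfall (mscale l x)).

Definition gen_series (l : 'X_{1..n}) (A : set 'X_{1..n})
    (g : 'X_{1..n} -> K) : fps :=
  fsum A (fun x => gen_term l x (g x)).

Definition Phi (l : 'X_{1..n}) (phi : 'X_{1..n} -> K) (t : Zn n) : fps :=
  gen_series l (nge t) phi.

Lemma gen_term_fsummable (l : 'X_{1..n}) (A : set 'X_{1..n})
    (g : 'X_{1..n} -> K) :
  fsummable A (fun x => gen_term l x (g x)).
Proof.
move=> y; apply: (@sub_finite_set _ _ [set y]%classic); last exact: finite_set1.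
by move=> x /= [_]; rewrite /gen_term /xi_term; case: eqP => [->|].
Qed.

Lemma gen_seriesE (l : 'X_{1..n}) (A : set 'X_{1..n}) (g : 'X_{1..n} -> K) y :
  gen_series l A g y = if y \in A then g y *: zfall (mscale l y) else 0.
Proof.
rewrite /gen_series /fsum; case: ifPn => yA.
  rewrite -(@fsbig_widen _ _ _ _ [set y]%classic).
  - by rewrite fsbig_set1 /gen_term /xi_term eqxx.
  - by move=> x ->; exact/set_mem.
  - move=> x [_ /= xy]; rewrite /gen_term /xi_term; case: eqP => // yx.
    by case: xy.
apply: fsbig1 => x Ax; rewrite /gen_term /xi_term; case: eqP => // yx.
by move: yA; rewrite yx mem_set.
Qed.

End Series.

(* Main.v *)
(* The identity z^{\underline{a+b}} = z^{\underline a} rho^a z^{\underline b} makes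
   xi^a z^{\underline{la}} rho^{la} send the term at x to the term at a + x.  All
   series are therefore compared at xi^y, where each is a scalar multiple of
   z^{\underline{ly}}: the scalar is P(delta^{-1}) f(y), which vanishes for y >= m,
   and for y not >= m every y - a with 0 <= a <= y still lies in X_m.  The
   truncations select exactly the pairs with a + x not >= m. *)
Require Import Defs.

Set Implicit Arguments.
Unset Strict Implicit.
Unset Printing Implicit Defensive.

Import GRing.Theory Num.Theory.
Local Open Scope ring_scope.

(** * Integer vectors versus multi-indices *)

Lemma leZn_zvec n (x y : 'X_{1..n}) : leZn (zvec x) (zvec y) = (x <= y)%MM.
Proof. by apply/forallP/mnm_lepP => h i; have := h i; rewrite !ffunE lez_nat. Qed.

Lemma leZn_subl n (t u v : Zn n) : leZn (t - u) v = leZn t (u + v).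
Proof.
by apply/forallP/forallP => h i; have := h i; rewrite !ffunE lerBlDl.
Qed.

Lemma zvecD n (x y : 'X_{1..n}) : zvec (x + y)%MM = zvec x + zvec y.
Proof. by apply/ffunP => i; rewrite !ffunE mnmDE PoszD. Qed.

Section Shift.
Variables (K : comNzRingType) (n : nat).
Implicit Types (l a b m x y : 'X_{1..n}) (p : {mpoly K[n]}).
Implicit Types (c g : 'X_{1..n} -> K).

(** Subtraction of multi-indices truncates at 0 and agrees with integer subtraction only under the
    guard [a <= x]; elsewhere the zero convention applies. *)
Lemma ext0_zvecB g x a :
  ext0 g (zvec x - zvec a) = if (a <= x)%MM then g (x - a)%MM else 0.
Proof.
have -> : (a <= x)%MM = [forall i, 0 <= (zvec x - zvec a) i].
  by apply/mnm_lepP/forallP => h i; have := h i; rewrite !ffunE subr_ge0 lez_nat.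
rewrite /ext0; case: ifPn => // /forallP xa; congr g.
apply/mnmP => i; rewrite !mnmE !ffunE; have := xa i.
by rewrite !ffunE subr_ge0 lez_nat => /subzn ->.
Qed.

(** * Backward shifts as substitutions *)

Lemma comp_mpoly_comp j k (u : j.-tuple {mpoly K[k]}) (q : {mpoly K[j]})
    (v : k.-tuple {mpoly K[n]}) :
  (q \mPo u) \mPo v = q \mPo [tuple tnth u i \mPo v | i < j].
Proof.
rewrite [q \mPo u]comp_mpolyEX [RHS]comp_mpolyEX raddf_sum /=.
apply: eq_bigr => a _; rewrite comp_mpolyZ !comp_mpolyX rmorph_prod /=.
by congr (_ *: _); apply: eq_bigr => i _; rewrite rmorphXn /= tnth_mktuple.
Qed.

(** The shift of all variables at once. A plain function [b] makes partial shifts, supported on some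
    of the variables, easy to write. *)
Definition translate (b : 'I_n -> nat) p :=
  p \mPo [tuple 'X_i - (b i)%:R | i < n].

Lemma translateX b i : translate b 'X_i = 'X_i - (b i)%:R.
Proof. by rewrite /translate comp_mpolyXU -tnth_nth tnth_mktuple. Qed.

Lemma translateD (b b' : 'I_n -> nat) p :
  translate b (translate b' p) = translate (fun i => b i + b' i)%N p.
Proof.
rewrite /translate comp_mpoly_comp; congr (_ \mPo _); apply: eq_from_tnth => i.
rewrite !tnth_mktuple raddfB /= rmorph_nat comp_mpolyXU -tnth_nth tnth_mktuple.
by rewrite natrD opprD addrA.
Qed.

Lemma eq_translate (b b' : 'I_n -> nat) p :
  b =1 b' -> translate b p = translate b' p.
Proof.
move=> e; rewrite /translate; congr (_ \mPo _).
by apply: eq_from_tnth => i; rewrite !tnth_mktuple e.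
Qed.

Lemma translate0 p : translate (fun=> 0%N) p = p.
Proof.
rewrite -[RHS]comp_mpoly_id /translate; congr (_ \mPo _).
by apply: eq_from_tnth => i; rewrite !tnth_mktuple subr0.
Qed.

Lemma iter_rho k j p : iter k (rho j) p = translate (fun i => (i == j) * k)%N p.
Proof.
elim: k => [|k IH].
  by rewrite -[LHS]translate0; apply: eq_translate => i; rewrite muln0.
by rewrite iterS IH [rho _ _]translateD; apply: eq_translate => i; rewrite mulnS.
Qed.

Lemma rho_powE b p : rho_pow b p = translate b p.
Proof.
(* Folding over a duplicate-free list [s] shifts exactly the variables in [s], each once. *)
have h (s : seq 'I_n) : uniq s ->
    foldr (fun j q => iter (b j) (rho j) q) p s
    = translate (fun i => (i \in s) * b i)%N p.
  elim: s => [|j s IH] /=; first by rewrite translate0.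
  move=> /andP[js us]; rewrite (IH us) iter_rho translateD.
  apply: eq_translate => i; rewrite in_cons; case: eqP => [->|_] //=.
  by rewrite (negbTE js) addn0.
rewrite /rho_pow h ?enum_uniq //.
by apply: eq_translate => i; rewrite mem_enum mul1n.
Qed.

(** * Falling factorials under shifts *)

Lemma ffallD (A : comNzRingType) (t : A) j k :
  ffall t (j + k) = ffall t j * ffall (t - j%:R) k.
Proof.
rewrite /ffall big_split_ord /=; congr (_ * _); apply: eq_bigr => i _.
by rewrite natrD opprD addrA.
Qed.

Lemma zfallD a b : zfall K (a + b)%MM = zfall K a * rho_pow a (zfall K b).
Proof.
rewrite rho_powE /zfall /translate rmorph_prod -big_split /=.
apply: eq_bigr => i _; rewrite mnmDE ffallD; congr (_ * _).
rewrite /ffall rmorph_prod /=; apply: eq_bigr => k _.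
by rewrite raddfB /= rmorph_nat [_ \mPo _]translateX.
Qed.

Lemma mscaleD l a b : mscale l (a + b)%MM = (mscale l a + mscale l b)%MM.
Proof. by apply/mnmP => i; rewrite !mnmE mulnDr. Qed.

Lemma shift_zfall l a x (k : K) :
  zfall K (mscale l a) * rho_pow (mscale l a) (k *: zfall K (mscale l x))
  = k *: zfall K (mscale l (a + x)%MM).
Proof.
by rewrite mscaleD zfallD !rho_powE /translate comp_mpolyZ scalerAr.
Qed.

(** * Coefficients of shifted series *)

Lemma shift_term_series l a (A : set 'X_{1..n}) g y :
  shift_term l a (gen_series l A g) y
  = (if (a <= y)%MM && ((y - a)%MM \in A) then g (y - a)%MM else 0)
    *: zfall K (mscale l y).
Proof.
rewrite /shift_term /mul_xi; case: ifPn => [ay|_] /=; last by rewrite scale0r.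
rewrite gen_seriesE; case: ifPn => _; first by rewrite shift_zfall addmC submK.
by rewrite rho_powE /translate raddf0 mulr0 scale0r.
Qed.

Lemma shift_term_gen_term l a x (k : K) y :
  shift_term l a (gen_term l x k) y
  = if y == (a + x)%MM then k *: zfall K (mscale l y) else 0.
Proof.
rewrite /shift_term /mul_xi /gen_term /xi_term.
case: (eqVneq y (a + x)%MM) => [->|yax].
  by rewrite lem_addr addmC addmK eqxx shift_zfall addmC.
case: ifPn => // ay; case: eqP => [e|_].
  by case/eqP: yax; rewrite -e addmC submK.
by rewrite rho_powE /translate raddf0 mulr0.
Qed.

(** The domain [A] may depend on [a]: this serves both the full series (constant [A]) and the series
    [Phi] truncated at m - a. *)
Lemma sum_shift_term_series m l c (A : 'X_{1..n} -> set 'X_{1..n}) g y :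
  (\sum_(a : 'X_{1..n < (mdeg m).+1} | (a <= m)%MM)
     c a *: shift_term l a (gen_series l (A a) g) : fps K n) y
  = (\sum_(a : 'X_{1..n < (mdeg m).+1} | (a <= m)%MM)
      c a * (if (a <= y)%MM && ((y - a)%MM \in A a) then g (y - a)%MM else 0))
    *: zfall K (mscale l y).
Proof.
rewrite fct_sumE scaler_suml; apply: eq_bigr => a _.
by rewrite scalrfctE shift_term_series scalerA.
Qed.

Lemma mem_nge (t : Zn n) x : (x \in nge t) = ~~ leZn t (zvec x).
Proof. by apply/idP/idP; rewrite inE. Qed.

Lemma leZn_zvec_sub m a x :
  leZn (zvec m - zvec a) (zvec x) = (m <= a + x)%MM.
Proof. by rewrite leZn_subl -zvecD leZn_zvec. Qed.

(** X_m is closed downwards, and truncated subtraction never exceeds [y]. *)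
Lemma nge_subm m a y : ~~ (m <= y)%MM -> nge (zvec m) (y - a)%MM.
Proof.
rewrite /nge /= leZn_zvec; apply: contra => h.
exact: lepm_trans h (lem_subr _ _).
Qed.

Lemma eq_Pdelta_inv m c g g' x :
  (forall a, (a <= x)%MM -> g (x - a)%MM = g' (x - a)%MM) ->
  Pdelta_inv m c (ext0 g) (zvec x) = Pdelta_inv m c (ext0 g') (zvec x).
Proof.
move=> gg'; apply: eq_bigr => a _; rewrite !ext0_zvecB.
by case: ifP => // /gg' ->.
Qed.

Lemma shift_op_series m l c g y :
  shift_op m l c (gen_series l [set: 'X_{1..n}]%classic g) y
  = Pdelta_inv m c (ext0 g) (zvec y) *: zfall K (mscale l y).
Proof.
rewrite /shift_op (sum_shift_term_series _ _ _ (fun=> setT)); congr (_ *: _); apply: eq_bigr => a _.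
by rewrite ext0_zvecB in_setT andbT.
Qed.

Lemma shift_Phi m l c g :
  \sum_(a : 'X_{1..n < (mdeg m).+1} | (a <= m)%MM)
     c a *: shift_term l a (Phi l g (zvec m - zvec a))
  = gen_series l (nge (zvec m))
      (fun x => Pdelta_inv m c (ext0 g) (zvec x)).
Proof.
apply/funext => y; rewrite gen_seriesE mem_nge leZn_zvec.
rewrite (sum_shift_term_series _ _ _ (fun a => nge (zvec m - zvec a))).
(* If a <= y, then y - a is not >= m - a exactly when y is not >= m. So membership is automatic for
   y in X_m, and otherwise every term vanishes. *)
case: ifPn => my.
  congr (_ *: _); apply: eq_bigr => a _; rewrite ext0_zvecB.
  case: ifPn => [/andP[-> _]//|]; case: ifP => //= ay.
  by rewrite mem_nge leZn_zvec_sub addmC submK // my.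
rewrite big1 ?scale0r // => a _; case: ifPn => [/andP[ay]|]; last by rewrite mulr0.
by rewrite mem_nge leZn_zvec_sub addmC submK // (negbTE my).
Qed.

(** * Truncated operators *)

(** The truncation says that a + x is not >= m. Since only y = a + x contributes at xi^y, it becomes
    a condition on [y] alone. *)
Lemma shift_op_truncE m l c x (k : K) y :
  shift_op_trunc m l c (zvec m - zvec x) (gen_term l x k) y
  = if ~~ (m <= y)%MM then
      \sum_(a : 'X_{1..n < (mdeg m).+1} | (a <= m)%MM && (y == (a + x)%MM))
        (c a * k) *: zfall K (mscale l y)
    else 0.
Proof.
rewrite /shift_op_trunc fct_sumE [LHS]big_mkcondr /=.
case: ifPn => my.
  rewrite [RHS]big_mkcondr; apply: eq_bigr => a _.
  rewrite leZn_zvec_sub scalrfctE shift_term_gen_term addmC.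
  case: eqP => [<-|_]; first by rewrite my scalerA.
  by rewrite scaler0 if_same.
apply: big1 => a _; rewrite leZn_zvec_sub scalrfctE shift_term_gen_term addmC.
case: eqP => [<-|_]; first by rewrite (negbTE my).
by rewrite scaler0 if_same.
Qed.

Lemma shift_op_trunc_neq0 m l c x (k : K) y :
  shift_op_trunc m l c (zvec m - zvec x) (gen_term l x k) y <> 0 ->
  exists a : 'X_{1..n < (mdeg m).+1},
    [/\ (a <= m)%MM, (a <= y)%MM & x = (y - a)%MM].
Proof.
move=> nz; apply: contrapT => h; apply: nz.
rewrite shift_op_truncE; case: ifP => // _; apply: big1 => a /andP[am /eqP ya].
by case: h; exists a; split; rewrite // ya ?lem_addr // addmC addmK.
Qed.

(** Ensures that the last series is a genuine sum and not the default value 0 of [fsum]: at xi^y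
    only the finitely many x = y - a contribute. *)
Lemma shift_op_trunc_fsummable m l c g :
  fsummable (nge (zvec m)) (fun x =>
    shift_op_trunc m l c (zvec m - zvec x) (gen_term l x (g x))).
Proof.
move=> y.
pose r := [seq (y - a)%MM | a : 'X_{1..n < (mdeg m).+1}].
apply: (@sub_finite_set _ _ [set` r]%classic); last exact: finite_seq.
move=> x /= [_ /shift_op_trunc_neq0[a [_ _ ->]]].
by apply/mapP; exists a; rewrite // mem_enum.
Qed.

Lemma Pdelta_inv_trunc m l c g :
  gen_series l (nge (zvec m)) (fun x => Pdelta_inv m c (ext0 g) (zvec x))
  = fsum (nge (zvec m)) (fun x =>
      shift_op_trunc m l c (zvec m - zvec x) (gen_term l x (g x))).
Proof.
apply/funext => y; rewrite gen_seriesE /fsum mem_nge leZn_zvec.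
case: ifPn => my; last first.
  by rewrite fsbig1 // => x _; rewrite shift_op_truncE (negbTE my).
(* The sum over [x] is reindexed by x = y - a; the bound a <= y makes this map injective on [s]. *)
pose s := [seq a : 'X_{1..n < (mdeg m).+1} <- index_enum _
             | (a <= m)%MM && (a <= y)%MM].
rewrite (@fsbigE _ _ _ _ _ [seq (y - a)%MM | a : 'X_{1..n < _} <- s]); first last.
- move=> x _ xs; apply: contrapT => /shift_op_trunc_neq0[a [am ay xE]].
  case/negP: xs; rewrite xE; apply/mapP; exists a => //.
  by rewrite mem_filter am ay mem_index_enum.
- by move=> x /= /mapP[a _ ->]; apply: nge_subm.
- rewrite map_inj_in_uniq ?filter_uniq ?index_enum_uniq // => a b.
  rewrite !mem_filter => /andP[/andP[_ ay] _] /andP[/andP[_ by_] _] e.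
  apply/val_inj/mnmP => i /=; move/mnmP/(_ i): e; rewrite !mnmE => e.
  by rewrite -(subKn (mnm_lepP ay i)) e (subKn (mnm_lepP by_ i)).
rewrite big_map big_filter_cond /Pdelta_inv scaler_suml.
(* Indices [a] not below [y] contribute nothing to the left side, by the zero convention. *)
rewrite [LHS](bigID (fun a : 'X_{1..n < _} => (a <= y)%MM)) /=.
rewrite [X in _ + X]big1 ?addr0; last first.
  by move=> a /andP[_ ay]; rewrite ext0_zvecB (negbTE ay) mulr0 scale0r.
apply: eq_big => a.
  by rewrite mem_set ?andbT //; apply: nge_subm.
move=> /andP[am ay]; rewrite ext0_zvecB ay shift_op_truncE my.
(* At x = y - a the condition y = b + x forces b = a, so the inner sum has a single term. *)
rewrite (big_pred1 a) // => b /=; apply/andP/eqP => [[_ /eqP e]|->]; last first.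
  by rewrite am addmC submK.
apply/val_inj/(@addIm _ (y - a)%MM) => /=.
by rewrite -e addmC submK.
Qed.

End Shift.

Theorem theorem3 (R : realType) (n : nat) (hn : (0 < n)%N)
    (m l : 'X_{1..n}) (c : 'X_{1..n} -> R[i])
    (phi f : 'X_{1..n} -> R[i])
    (heq : forall x : 'X_{1..n}, (m <= x)%MM ->
       Pdelta_inv m c (ext0 f) (zvec x) = 0)
    (hinit : forall x : 'X_{1..n}, nge (zvec m) x -> f x = phi x) :
  let F := gen_series l [set: 'X_{1..n}]%classic f in
  let S1 := \sum_(a : 'X_{1..n < (mdeg m).+1} | (a <= m)%MM)
              c a *: shift_term l a (Phi l phi (zvec m - zvec a)) in
  let S2 := gen_series l (nge (zvec m))
              (fun x => Pdelta_inv m c (ext0 phi) (zvec x)) in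
  let G3 := fun x : 'X_{1..n} =>
              shift_op_trunc m l c (zvec m - zvec x) (gen_term l x (phi x)) in
  [/\ shift_op m l c F = S1,
      S1 = S2,
      fsummable (nge (zvec m)) G3
    & S2 = fsum (nge (zvec m)) G3].
Proof.
move=> F S1 S2 G3; have S12 : S1 = S2 by exact: shift_Phi.
split; [|exact: S12|exact: shift_op_trunc_fsummable|exact: Pdelta_inv_trunc].
rewrite S12; apply/funext => y.
rewrite shift_op_series /S2 gen_seriesE mem_nge leZn_zvec.
(* For y >= m the recurrence gives 0; on X_m the values of [f] that occur are those of [phi]. *)
case: ifPn => my; last by rewrite heq ?scale0r //; apply: contraNT my.
by congr (_ *: _); apply: eq_Pdelta_inv => a _; apply/hinit/nge_subm.
Qed.
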